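(* Let $f:X\to Y$ be an MR-map between topological spaces. Then the Boolean algebras $RC(X)$ and $RC(Y)$ are isomorphic. If, moreover, $X$ and $Y$ are $\pi$-semiregular spaces, then $\pi w(X)=\pi w(Y)$.
   Context: $RC(X)$ is the Boolean algebra of regular closed subsets of $X$ ($F=\mathrm{cl}(\mathrm{int}(F))$), with $F\vee G=F\cup G$, $F\wedge G=\mathrm{cl}(\mathrm{int}(F\cap G))$, $F^*=\mathrm{cl}(X\setminus F)$. $RO(X)$ is the family of regular open subsets of $X$ ($U=\mathrm{int}(\mathrm{cl}(U))$). For a function $f:X\to Y$ and $U\subseteq X$, $f^\sharp(U)=\{y\in Y\mid f^{-1}(y)\subseteq U\}$. A continuous map $f:X\to Y$ is an MR-map if $\mathrm{cl}(f(X))=Y$ and $\mathrm{int}(f^\sharp(U))\neq\emptyset$ for every non-empty $U\in RO(X)$. A family $\mathcal{B}$ of open subsets of $X$ is a $\pi$-base of $X$ if for each non-empty open $U\subseteq X$ there is a non-empty $V\in\mathcal{B}$ with $V\subseteq U$; $\pi w(X)=\min\{|\mathcal{B}|\mid\mathcal{B}\text{ is a }\pi\text{-base of }X\}$. A space $X$ is $\pi$-semiregular if $RO(X)$ is a $\pi$-base of $X$. *)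

(* Defs.v *)
From HB Require Import structures.
From mathcomp Require Import all_boot all_order.
From mathcomp Require Import boolp classical_sets functions cardinality.
From mathcomp Require Import topology_structure.

Set Implicit Arguments.
Unset Strict Implicit.
Unset Printing Implicit Defensive.

Import Order.Theory.
Local Open Scope classical_set_scope.
Local Open Scope card_scope.

(* [regclosed] is boolean-reflected here only so that the subtype inherits the
   equality and choice structures of [set X]. *)
Record RC (X : topologicalType) := MkRC {
  rc_set :> set X;
  rc_prop : `[< regclosed rc_set >] }.

HB.instance Definition _ (X : topologicalType) := [isSub for @rc_set X].
HB.instance Definition _ (X : topologicalType) := [Choice of RC X by <:].

Fact RC_display : Order.disp_t. Proof. exact: Order.Disp tt tt. Qed.

Section RegularClosedAlgebra.
Variable X : topologicalType.
Implicit Types F G H : RC X.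

Lemma rcP F : regclosed F.
Proof. exact/asboolP/rc_prop. Qed.

Lemma rc_inj F G : F = G :> set X -> F = G.
Proof. exact: val_inj. Qed.

Lemma rc_closed F : closed F.
Proof. by rewrite -(rcP F); exact: closed_closure. Qed.

Lemma regclosedU (A B : set X) :
  regclosed A -> regclosed B -> regclosed (A `|` B).
Proof.
move=> rA rB; rewrite /regclosed eqEsubset; split.
- have cl : closed (A `|` B).
    by apply: closedU; [rewrite -rA|rewrite -rB]; exact: closed_closure.
  by rewrite {2}((closure_id _).1 cl); apply: closureS; exact: interior_subset.
- rewrite -{1}rA -{1}rB -closureU; apply: closureS; exact: interiorU.
Qed.

Lemma regclosed_closure_interior (A : set X) : regclosed (closure A°).
Proof. exact/closure_open_regclosed/open_interior. Qed.

Lemma regclosed0 : regclosed (@set0 X).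
Proof. by rewrite /regclosed interior0 closure0. Qed.

Lemma regclosedT : regclosed [set: X].
Proof. by rewrite /regclosed interiorT closureT. Qed.

Lemma regclosed_closureC F : regclosed (closure (~` F)).
Proof. by apply: closure_open_regclosed; rewrite openC; exact: rc_closed. Qed.

Definition rc_join F G : RC X := MkRC (asboolT (regclosedU (rcP F) (rcP G))).
Definition rc_meet F G : RC X :=
  MkRC (asboolT (regclosed_closure_interior (F `&` G))).
Definition rc_compl F : RC X := MkRC (asboolT (regclosed_closureC F)).
Definition rc_bot : RC X := MkRC (asboolT regclosed0).
Definition rc_top : RC X := MkRC (asboolT regclosedT).
Definition rc_le F G : bool := `[< F `<=` G >].

Lemma rc_le_refl : reflexive rc_le.
Proof. by move=> F; exact/asboolP. Qed.

Lemma rc_le_anti : antisymmetric rc_le.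
Proof.
by move=> F G /andP[/asboolP FG /asboolP GF]; apply: rc_inj; exact/seteqP.
Qed.

Lemma rc_le_trans : transitive rc_le.
Proof.
by move=> G F H /asboolP FG /asboolP GH; apply/asboolP; exact: subset_trans GH.
Qed.

HB.instance Definition _ := @Order.Le_isPOrder.Build RC_display (RC X)
  rc_le rc_le_refl rc_le_anti rc_le_trans.

Lemma rc_meet_subl F G : rc_meet F G `<=` F.
Proof. by rewrite -[X in _ `<=` X](rcP F); apply/closureS/interiorS; exact: subIsetl. Qed.

Lemma rc_meet_subr F G : rc_meet F G `<=` G.
Proof. by rewrite -[X in _ `<=` X](rcP G); apply/closureS/interiorS; exact: subIsetr. Qed.

Lemma sub_rc_meet F G H : H `<=` F -> H `<=` G -> H `<=` rc_meet F G.
Proof.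
move=> HF HG; rewrite -(rcP H); apply/closureS/interiorS.
by rewrite subsetI.
Qed.

Lemma rc_meetC : commutative rc_meet.
Proof. by move=> F G; apply: rc_inj; rewrite /= setIC. Qed.

Lemma rc_joinC : commutative rc_join.
Proof. by move=> F G; apply: rc_inj; rewrite /= setUC. Qed.

Lemma rc_meetA : associative rc_meet.
Proof.
move=> F G H; apply: rc_inj; apply/seteqP; split.
- have FGH := @rc_meet_subr F (rc_meet G H).
  apply: sub_rc_meet; last exact: subset_trans FGH (@rc_meet_subr _ _).
  apply: sub_rc_meet; first exact: rc_meet_subl.
  exact: subset_trans FGH (@rc_meet_subl _ _).
- have FGH := @rc_meet_subl (rc_meet F G) H.
  apply: sub_rc_meet; first exact: subset_trans FGH (@rc_meet_subl _ _).
  apply: sub_rc_meet; last exact: rc_meet_subr.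
  exact: subset_trans FGH (@rc_meet_subr _ _).
Qed.

Lemma rc_joinA : associative rc_join.
Proof. by move=> F G H; apply: rc_inj; rewrite /= setUA. Qed.

Lemma rc_joinKI G F : rc_meet F (rc_join F G) = F.
Proof. by apply: rc_inj; rewrite /= setIC setUK; exact: rcP. Qed.

Lemma rc_meetKU G F : rc_join F (rc_meet F G) = F.
Proof. by apply: rc_inj; apply/setUidPl; exact: rc_meet_subl. Qed.

Lemma rc_leEmeet F G : (F <= G)%O = (rc_meet F G == F).
Proof.
apply/asboolP/eqP => [FG|<-]; last exact: rc_meet_subr.
by apply: rc_inj; rewrite /= setIidl//; exact: rcP.
Qed.

Lemma rc_meetUl : left_distributive rc_meet rc_join.
Proof.
move=> F G H; apply: rc_inj; apply/seteqP; split; last first.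
  rewrite /= subUset; split; apply: closureS; apply: interiorS; apply: setSI.
    exact: subsetUl.
  exact: subsetUr.
have aux (K : RC X) : K `&` H° `<=` closure (K `&` H)°.
  move=> x [Kx Hx] N Nx; move: Kx; rewrite -{1}(rcP K) => /(_ (N `&` H°)).
  case=> [|y [Ky [Ny Hy]]].
    apply: filterI => //; apply: open_nbhs_nbhs.
    by split=> //; exact: open_interior.
  by exists y; split=> //; rewrite interiorI.
have cl : closed (rc_join (rc_meet F H) (rc_meet G H)) by exact: rc_closed.
rewrite [X in _ `<=` X]((closure_id _).1 cl); apply: closureS.
rewrite /= interiorI => x [/interior_subset[Fx|Gx] Hx].
- by left; exact: aux.
- by right; exact: aux.
Qed.

HB.instance Definition _ :=
  @Order.POrder_Meet_isDistrLattice.Build RC_display (RC X) rc_meet rc_join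
    rc_meetC rc_joinC rc_meetA rc_joinA rc_joinKI rc_meetKU rc_leEmeet rc_meetUl.

Lemma rc_le0 F : (rc_bot <= F)%O.
Proof. by apply/asboolP; exact: sub0set. Qed.

Lemma rc_le1 F : (F <= rc_top)%O.
Proof. exact/asboolP. Qed.

HB.instance Definition _ :=
  @Order.hasBottom.Build RC_display (RC X) rc_bot rc_le0.
HB.instance Definition _ := @Order.hasTop.Build RC_display (RC X) rc_top rc_le1.

Lemma rc_joinxC F : Order.join F (rc_compl F) = Order.top.
Proof.
apply: rc_inj; apply/seteqP; split=> // x _.
by have [Fx|nFx] := pselect (rc_set F x); [left|right; exact: subset_closure].
Qed.

Lemma rc_meetxC F : Order.meet F (rc_compl F) = Order.bottom.
Proof.
apply: rc_inj; rewrite /= interiorI closure_setC interiorC.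
rewrite (rcP F) (_ : _ `&` _ = set0) ?closure0//.
by rewrite -subset0 => x [/interior_subset].
Qed.

HB.instance Definition _ :=
  @Order.TBDistrLattice_hasComplement.Build RC_display (RC X)
    rc_compl rc_joinxC rc_meetxC.

End RegularClosedAlgebra.

Definition boolean_isomorphic d d' (A : ctbDistrLatticeType d)
    (B : ctbDistrLatticeType d') : Prop :=
  exists phi : A -> B,
    [/\ bijective phi,
        Order.meet_morphism phi,
        Order.join_morphism phi,
        {morph phi : a / Order.compl a} &
        phi Order.bottom = Order.bottom /\ phi Order.top = Order.top].

Definition fsharp (X Y : Type) (f : X -> Y) (U : set X) : set Y :=
  [set y | f @^-1` [set y] `<=` U].

Definition MR_map (X Y : topologicalType) (f : X -> Y) : Prop :=
  [/\ continuous f,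
      closure (range f) = [set: Y] &
      forall U : set X, regopen U -> U !=set0 -> (fsharp f U)° !=set0].

Definition pi_base (X : topologicalType) (B : set (set X)) : Prop :=
  (forall V, B V -> open V) /\
  (forall U : set X, open U -> U !=set0 ->
     exists V, [/\ B V, V !=set0 & V `<=` U]).

Definition pi_semiregular (X : topologicalType) : Prop :=
  pi_base [set U : set X | regopen U].

Definition minimum_pi_base (X : topologicalType) (B : set (set X)) : Prop :=
  pi_base B /\ forall B' : set (set X), pi_base B' -> B #<= B'.

(* Cardinal numbers are represented by sets up to equinumerosity [#=]: the
   pi-weight is the cardinal of an arbitrarily chosen pi-base of least
   cardinality, which exists by [pi_weightP]. *)
Definition pi_weight (X : topologicalType) : set (set X) :=
  xget set0 [set B | minimum_pi_base B].
Arguments pi_weight : clear implicits.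

Lemma card_min_exists (T : pointedType) (P : set (set T)) :
  P !=set0 -> exists2 A, P A & forall B, P B -> A #<= B.
Proof.
move=> [A0 PA0].
pose I := set T.
pose Q : set (set (I -> T)) := [set S |
  (forall t B, S t -> P B -> B (t B)) /\
  (forall t u B, S t -> S u -> P B -> t B = u B -> t = u)].
have [F FQ Ftot|S [[SB Sinj] Smax]] := @Zorn_bigcup _ Q.
  split=> [t B [Z FZ Zt]|t u B [Z FZ Zt] [W FW Wu]].
    exact: (FQ _ FZ).1 Zt.
  have [ZW|WZ] := Ftot _ _ FZ FW.
    exact: (FQ _ FW).2 (ZW _ Zt) Wu.
  exact: (FQ _ FZ).2 Zt (WZ _ Wu).
have [A PA AS] : exists2 A, P A & A `<=` [set t A | t in S].
  apply: contrapT => noA.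
  have ex B : exists x, P B -> B x /\ forall t, S t -> t B <> x.
    have [PB|nPB] := pselect (P B); last by exists point.
    apply: contrapT => /forallNP nx; apply: noA; exists B => // x Bx.
    apply: contrapT => nSx; apply: (nx x) => _; split => // t St tx.
    by apply: nSx; exists t.
  have [u uP] := choice ex.
  apply: (Smax (u |` S)).
    split=> [|uS]; first exact: subsetUr.
    by have /uP[_ /(_ u)] := PA0; apply => //; apply: uS; left.
  split=> [t B [->|St] PB|t v B [->|St] [->|Sv] PB //].
  - exact: (uP B PB).1.
  - exact: SB St PB.
  - by move=> e; case: ((uP B PB).2 v Sv); rewrite e.
  - by move=> e; case: ((uP B PB).2 t St).
  - exact: Sinj St Sv PB.
exists A => // B PB.
have /choice[g gP] : forall x, exists t, A x -> S t /\ t A = x.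
  move=> x; have [/AS[t St tx]|nAx] := pselect (A x); first by exists t.
  by exists (fun=> point).
apply/pcard_leP/injfunPex; exists (fun x => g x B).
  by move=> x /gP[Sg _]; exact: SB Sg PB.
move=> x y /set_mem /gP[Sgx gx] /set_mem /gP[Sgy gy] e.
by rewrite -gx -gy (Sinj _ _ B Sgx Sgy PB e).
Qed.

Lemma pi_base_open (X : topologicalType) : pi_base [set U : set X | open U].
Proof. by split=> // U oU U0; exists U; split. Qed.

Lemma pi_weightP (X : topologicalType) : minimum_pi_base (pi_weight X).
Proof.
have [|A PA minA] := @card_min_exists (set X) [set B | pi_base B].
  by exists [set U | open U]; exact: pi_base_open.
by rewrite /pi_weight; case: xgetP => [B _ //|/(_ A)]; case.
Qed.

(* Main.v *)
(* The isomorphism and its inverse are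
     phi F = cl (int (f# (int F)))  and  psi G = cl (f^-1 (int G)).
   Both are monotone, and they are mutually inverse: since the range of f is
   dense, the preimage of a non-empty open set is non-empty, while the MR
   condition, applied to the regular open hull of a non-empty open set W, gives
   a non-empty open subset of Y whose preimage is open, non-empty and contained
   in cl W, hence meets W.  For pi-weights, preimages of the members of a
   pi-base of Y form a pi-base of X, and the sets int (f# (int (cl V))), for V
   in a pi-base of X, form a pi-base of Y. *)
Require Import Defs.
From HB Require Import structures.
From mathcomp Require Import all_boot all_order.
From mathcomp Require Import boolp classical_sets functions cardinality.
From mathcomp Require Import topology_structure.

Import Order.Theory.

Local Open Scope classical_set_scope.
Local Open Scope card_scope.

(** Mutually inverse monotone maps are adjoint to each other on both sides, so [phi] preserves
    meets, joins and bounds. Complements follow, being determined by these. *)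
Lemma order_iso_boolean_isomorphic d d' (A : ctbDistrLatticeType d)
    (B : ctbDistrLatticeType d') (phi : A -> B) (psi : B -> A) :
  cancel phi psi -> cancel psi phi ->
  {homo phi : a b / (a <= b)%O} -> {homo psi : a b / (a <= b)%O} ->
  boolean_isomorphic A B.
Proof.
move=> phiK psiK phi_le psi_le.
have le_phi a b : (phi a <= b)%O = (a <= psi b)%O.
  by apply/idP/idP => [/psi_le|/phi_le]; rewrite ?phiK ?psiK.
have phi_ge a b : (b <= phi a)%O = (psi b <= a)%O.
  by apply/idP/idP => [/psi_le|/phi_le]; rewrite ?phiK ?psiK.
have phiI : Order.meet_morphism phi.
  move=> a b; apply/le_anti/andP; split.
    by rewrite lexI !phi_le // ?leIl ?leIr.
  by rewrite phi_ge lexI -!phi_ge leIl leIr.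
have phiU : Order.join_morphism phi.
  move=> a b; apply/le_anti/andP; split.
    by rewrite le_phi leUx -!le_phi leUl leUr.
  by rewrite leUx !phi_le // ?leUl ?leUr.
have phi0 : phi Order.bottom = Order.bottom.
  by apply/eqP; rewrite -lex0 le_phi le0x.
have phi1 : phi Order.top = Order.top.
  by apply/eqP; rewrite -le1x phi_ge lex1.
exists phi; split=> //; first by exists psi.
move=> a; apply/le_anti/andP; split.
  by rewrite -disj_leC -phiI meetCx phi0.
(* By double complementation the inequality becomes a disjointness, which De Morgan turns into:
   [phi a] and the image of the complement of [a] join to top. *)
rewrite -[phi (Order.compl a)]complK -disj_leC -complU -phiU joinxC phi1.
by rewrite compl1.
Qed.

Lemma open_meets_closure {T : topologicalType} (U A : set T) :
  open U -> U `&` closure A !=set0 -> U `&` A !=set0.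
Proof.
move=> oU [x [Ux clAx]].
have [|y [Ay Uy]] := clAx U; first exact: open_nbhs_nbhs.
by exists y.
Qed.

(** Any neighbourhood of a point of [U] shrinks to an open one inside [U], so density need only be
    tested there. *)
Lemma sub_closure_meets {T : topologicalType} (U A : set T) : open U ->
  (forall W, open W -> W `<=` U -> W !=set0 -> W `&` A !=set0) ->
  U `<=` closure A.
Proof.
move=> oU UA x Ux N; rewrite nbhsE => -[W [oW Wx] WN].
have [||y [[Wy _] Ay]] := UA (W `&` U) (openI oW oU); first exact: subIsetr.
  by exists x.
by exists y; split=> //; exact: WN.
Qed.

Section MRMap.
Context {X Y : topologicalType} {f : X -> Y}.
Hypothesis hf : MR_map f.

Let open_pre (V : set Y) : open V -> open (f @^-1` V).
Proof. by case: hf => /continuousP + _ _; exact. Qed.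

Lemma MR_preimage_neq0 (V : set Y) :
  open V -> V !=set0 -> f @^-1` V !=set0.
Proof.
case: hf => _ df _ oV [y Vy].
have [|z [Vz [x _ fxz]]] := @open_meets_closure _ V (range f) oV.
  by exists y; rewrite df.
by exists x; rewrite /= fxz.
Qed.

Lemma preimage_interior_fsharp (U : set X) : f @^-1` (fsharp f U)° `<=` U.
Proof. by move=> x /interior_subset; apply. Qed.

Lemma fsharpS (U V : set X) : U `<=` V -> fsharp f U `<=` fsharp f V.
Proof. by move=> UV y /subset_trans; apply. Qed.

Lemma MR_fsharp_hull_neq0 {W : set X} : open W -> W !=set0 ->
  (fsharp f (closure W)°)° !=set0.
Proof.
case: hf => _ _ MR oW [x Wx]; apply: MR.
  exact/interior_closed_regopen/closed_closure.
exists x; apply: (interiorS (@subset_closure _ W)).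
by rewrite ((interior_id _).1 oW).
Qed.

(** Turns an intersection in Y into one in X: the preimage of the non-empty open set [P] ∩ [O] is
    non-empty and lies in cl [W], so the open preimage of [O] meets cl [W], hence [W]. *)
Lemma MR_preimage_meets (W : set X) (O : set Y) : open W -> open O ->
  (fsharp f (closure W)°)° `&` O !=set0 -> W `&` f @^-1` O !=set0.
Proof.
move=> oW oO PO0; set P := (fsharp f (closure W)°)° in PO0.
have oPO : open (P `&` O) by apply: openI => //; exact: open_interior.
have [x [Px Ox]] := MR_preimage_neq0 _ oPO PO0.
rewrite setIC; apply: open_meets_closure; first exact: open_pre.
exists x; split=> //; exact: interior_subset (preimage_interior_fsharp _ _ Px).
Qed.

Lemma MR_sub_closure_preimage (U : set X) : regopen U ->
  U `<=` closure (f @^-1` (fsharp f U)°).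
Proof.
move=> rU; apply: sub_closure_meets => [|W oW WU W0].
  by rewrite -rU; exact: open_interior.
apply: MR_preimage_meets => //; first exact: open_interior.
rewrite setIidl; first exact: MR_fsharp_hull_neq0.
(* Regular openness of [U] keeps the hull int cl [W] inside [U]. *)
apply: interiorS; apply: fsharpS; rewrite -rU.
by apply: interiorS; exact: closureS.
Qed.

Lemma MR_preimage_closure_interior (U : set X) : open U ->
  f @^-1` (closure (fsharp f U)°)° `<=` closure U.
Proof.
move=> oU; have oV := @open_interior _ (closure (fsharp f U)°).
apply: sub_closure_meets => [|W oW WV W0]; first exact: open_pre.
(* Write P for int f#(int cl [W]) and O for int f#([U]). Since [W] meets the preimage of P and maps
   into cl O, the open set P meets cl O, hence O; so [W] meets the preimage of O. *)
have [x [Wx Ox]] : W `&` f @^-1` (fsharp f U)° !=set0.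
  apply: MR_preimage_meets => //; first exact: open_interior.
  apply: open_meets_closure; first exact: open_interior.
  have [x [Wx Px]] : W `&` f @^-1` (fsharp f (closure W)°)° !=set0.
    apply: MR_preimage_meets => //; first exact: open_interior.
    by rewrite setIid; exact: MR_fsharp_hull_neq0.
  by exists (f x); split=> //; apply: interior_subset; exact: WV.
by exists x; split=> //; exact: preimage_interior_fsharp Ox.
Qed.

Lemma MR_interior_fsharp_preimage (V : set Y) : open V ->
  (fsharp f (closure (f @^-1` V))°)° `<=` closure V.
Proof.
move=> oV; apply: sub_closure_meets => [|W oW WV W0].
  exact: open_interior.
have [x Wx] := MR_preimage_neq0 _ oW W0.
have [|z [Wz Vz]] :=
  @open_meets_closure _ (f @^-1` W) (f @^-1` V) (open_pre _ oW).
  exists x; split=> //; apply: interior_subset; apply: preimage_interior_fsharp.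
  exact: WV.
by exists (f z).
Qed.

Lemma sub_interior_fsharp_preimage (V : set Y) : open V ->
  V `<=` (fsharp f (closure (f @^-1` V))°)°.
Proof.
move=> oV; rewrite -{1}((interior_id _).1 oV).
apply: interiorS => y Vy x /= fxy.
rewrite -fxy in Vy; apply: (interiorS (@subset_closure _ (f @^-1` V))).
by rewrite ((interior_id _).1 (open_pre _ oV)).
Qed.

Definition RC_push (F : RC X) : RC Y :=
  MkRC (asboolT (regclosed_closure_interior (fsharp f F°))).

Definition RC_pull (G : RC Y) : RC X :=
  MkRC (asboolT (closure_open_regclosed (open_pre _ (@open_interior _ G)))).

Lemma RC_pushK : cancel RC_push RC_pull.
Proof.
move=> F; apply: rc_inj; apply/seteqP; split=> /=.
  have := MR_preimage_closure_interior _ (@open_interior _ F).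
  by rewrite (rcP F) => /closureS; rewrite -((closure_id _).1 (@rc_closed _ F)).
(* As [F] is the closure of its interior, it suffices to place the regular open set int [F] inside
   the closed right-hand side. *)
have cU := @closed_closure _ (f @^-1` (closure (fsharp f F°)°)°).
rewrite -{1}(rcP F) ((closure_id _).1 cU); apply: closureS.
have rU := interior_closed_regopen (@rc_closed _ F).
apply: subset_trans (MR_sub_closure_preimage _ rU) _.
apply: closureS => x Ox.
apply: (interiorS (@subset_closure _ _)).
by rewrite ((interior_id _).1 (@open_interior _ _)).
Qed.

Lemma RC_pullK : cancel RC_pull RC_push.
Proof.
move=> G; apply: rc_inj; have oG := @open_interior _ G.
apply/seteqP; split=> /=.
  have := MR_interior_fsharp_preimage _ oG.
  by rewrite (rcP G) => /closureS; rewrite -((closure_id _).1 (@rc_closed _ G)).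
by rewrite -{1}(rcP G); apply: closureS; exact: sub_interior_fsharp_preimage.
Qed.

Lemma RC_push_le : {homo RC_push : F G / (F <= G)%O}.
Proof.
move=> F G /asboolP FG; apply/asboolP; apply: closureS; apply: interiorS.
apply: fsharpS; exact: interiorS.
Qed.

Lemma RC_pull_le : {homo RC_pull : F G / (F <= G)%O}.
Proof.
move=> F G /asboolP FG; apply/asboolP; apply: closureS; apply: preimage_subset.
exact: interiorS.
Qed.

Lemma pi_base_preimage (B : set (set Y)) : pi_semiregular X -> pi_base B ->
  pi_base [set f @^-1` V | V in B].
Proof.
move=> [_ sX] [oB dB]; split=> [_ [V BV <-]|U oU U0].
  by apply: open_pre; exact: oB.
(* The MR condition speaks of regular open sets only, so [U] is first shrunk to one. *)
have [U' [rU' U'0 U'U]] := sX U oU U0.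
have [_ _ /(_ U' rU' U'0) O0] := hf.
have [V [BV V0 VU']] := dB _ (@open_interior _ (fsharp f U')) O0.
exists (f @^-1` V); split; first by exists V.
  by apply: MR_preimage_neq0 => //; exact: oB.
apply: subset_trans U'U; apply: subset_trans (preimage_interior_fsharp U').
exact: preimage_subset.
Qed.

Lemma pi_base_fsharp (B : set (set X)) : pi_semiregular Y -> pi_base B ->
  pi_base [set (fsharp f (closure V)°)° | V in B].
Proof.
move=> [_ sY] [oB dB]; split=> [_ [V BV <-]|W oW W0].
  exact: open_interior.
have [W' [rW' W'0 W'W]] := sY W oW W0.
have oW' : open W' by rewrite -rW'; exact: open_interior.
have [V [BV V0 VW']] := dB _ (open_pre _ oW') (MR_preimage_neq0 _ oW' W'0).
exists (fsharp f (closure V)°)°; split; first by exists V.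
  by apply: MR_fsharp_hull_neq0 => //; exact: oB.
(* From [V] inside the preimage of [W'], the open set built on [V] lies in cl [W'], hence in int cl
   [W'], which is [W'] by regularity. *)
apply: subset_trans W'W; rewrite -rW'.
rewrite -((interior_id _).1 (@open_interior _ (fsharp _ _))).
apply/interiorS/(subset_trans _ (MR_interior_fsharp_preimage _ oW')).
by apply: interiorS; apply: fsharpS; exact/interiorS/closureS.
Qed.

End MRMap.

(** The [g]-image of a least pi-base of Y is a pi-base of X with no more members. *)
Lemma pi_weight_le {X Y : topologicalType} (g : set Y -> set X) :
  (forall B, pi_base B -> pi_base (g @` B)) -> pi_weight X #<= pi_weight Y.
Proof.
move=> gP; have [_ minX] := pi_weightP X; have [bY _] := pi_weightP Y.
exact: card_le_trans (minX _ (gP _ bY)) (card_image_le _ _).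
Qed.

Theorem proposition4p13 (X Y : topologicalType) (f : X -> Y) (hf : MR_map f) :
  boolean_isomorphic (RC X) (RC Y) /\
  (pi_semiregular X -> pi_semiregular Y -> pi_weight X #= pi_weight Y).
Proof.
split=> [|sX sY].
  apply: order_iso_boolean_isomorphic (RC_pushK hf) (RC_pullK hf) _ _.
    exact: RC_push_le.
  exact: RC_pull_le.
apply/card_eqPle; split; apply: pi_weight_le => B.
  exact: (pi_base_preimage hf).
exact: (pi_base_fsharp hf).
Qed.
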